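(* Assume $\operatorname{char}(\Bbbk)\neq 2$. Let $B$ and $D$ be $\Bbbk$-algebras. Let $M_\bullet:\ \cdots\to P_1\xrightarrow{d_1}P_0\xrightarrow{d_0}M\to 0$ be an acyclic complex of $B$-modules admitting a $B$-homotopy $h_\bullet$, and let $P_\bullet:\ \cdots\to P_1\to P_0\to 0$ be its deleted version. Similarly, let $N_\bullet:\ \cdots\to Q_1\xrightarrow{\delta_1}Q_0\xrightarrow{\delta_0}N\to 0$ be an acyclic complex of $D$-modules admitting a $D$-homotopy $\eta_\bullet$, and let $Q_\bullet:\ \cdots\to Q_1\to Q_0\to 0$ be its deleted version. Then $$\operatorname{Tot}(P_\bullet\otimes Q_\bullet)\xrightarrow{\ \Delta_0\ }M\otimes N\to 0,\qquad \Delta_0=d_0\otimes\delta_0,$$ is an acyclic complex of $B\otimes D$-modules admitting a $B\otimes D$-homotopy.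
   Context: Throughout, $\Bbbk$ is a perfect field and all algebras are Artin algebras over $\Bbbk$; $\otimes=\otimes_\Bbbk$; modules are finitely generated left modules. A complex $(M_n,d_n)$ is said to admit a $B$-homotopy if there are $B$-linear maps $h_n:M_n\to M_{n+1}$ with $d_{n+1}h_n+h_{n-1}d_n=1_{M_n}$ for all indices $n$. Here $M$ and $N$ sit in degree $-1$ of $M_\bullet$ and $N_\bullet$. The total complex has components $\operatorname{Tot}(P_\bullet\otimes Q_\bullet)_s=\bigoplus_{n+m=s}P_n\otimes Q_m$ and differential in degree $s$ equal to $\sum_{n+m=s}\bigl(d_n\otimes 1_{Q_m}+(-1)^n 1_{P_n}\otimes\delta_m\bigr)$, where $d$ and $\delta$ denote the differentials of the deleted complexes $P_\bullet$ and $Q_\bullet$; the map $\Delta_0$ is defined on the degree-$0$ component $P_0\otimes Q_0$. *)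

(* Defs.v *)
From HB Require Import structures.
From mathcomp Require Import all_boot all_order all_algebra all_field.
From mathcomp Require Import boolp.

Set Implicit Arguments.
Unset Strict Implicit.
Unset Printing Implicit Defensive.

Import GRing.Theory.

Local Open Scope ring_scope.
Local Open Scope quotient_scope.

Definition perfect_field (k : fieldType) : Prop :=
  forall p : {poly k}, irreducible_poly p -> separable_poly p.

Definition fg_module (R : pzRingType) (M : lmodType R) : Prop :=
  exists s : seq M, forall x : M,
    exists c : 'I_(size s) -> R, x = \sum_(i < size s) c i *: s`_i.

(** * Tensor products of vector spaces *)

Section Tensor.
Variables (k : fieldType) (U V : lmodType k).

Definition formal_eval (W : lmodType k) (phi : U -> V -> W) (s : seq (U * V)) :=
  \sum_(p <- s) phi p.1 p.2.

(* A sequence [:: (u1, v1); ...; (un, vn)] stands for u1 (x) v1 + ... +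
   un (x) vn.  Two such formal sums are identified when no bilinear map
   separates them; [tensor_lift], [tensor_liftE] and [tensor_lift_uniq] below
   establish the universal property of the quotient. *)
Definition tensor_rel (s t : seq (U * V)) : bool :=
  `[< forall (W : lmodType k) (phi : {bilinear U -> V -> W}),
        formal_eval phi s = formal_eval phi t >].

Lemma tensor_rel_refl : reflexive tensor_rel.
Proof. by move=> s; apply/asboolP. Qed.

Lemma tensor_rel_sym : symmetric tensor_rel.
Proof.
by move=> s t; apply/asboolP/asboolP => st W phi; rewrite st.
Qed.

Lemma tensor_rel_trans : transitive tensor_rel.
Proof.
move=> t s r /asboolP st /asboolP tr.
by apply/asboolP => W phi; rewrite st tr.
Qed.

Canonical tensor_equiv :=
  EquivRel tensor_rel tensor_rel_refl tensor_rel_sym tensor_rel_trans.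

Definition tensor := {eq_quot tensor_equiv}.
HB.instance Definition _ := Choice.on tensor.
HB.instance Definition _ := EqQuotient.on tensor.

Definition sum_class (s : seq (U * V)) : tensor := \pi_tensor s.

Lemma sum_classP s t : reflect
  (forall (W : lmodType k) (phi : {bilinear U -> V -> W}),
     formal_eval phi s = formal_eval phi t) (sum_class s == sum_class t).
Proof. by rewrite /sum_class eqmodE; apply: asboolP. Qed.

Lemma sum_classK (x : tensor) : sum_class (repr x) = x.
Proof. exact: reprK. Qed.

Lemma formal_eval_repr (W : lmodType k) (phi : {bilinear U -> V -> W}) s :
  formal_eval phi (repr (sum_class s)) = formal_eval phi s.
Proof. by apply/sum_classP; rewrite sum_classK. Qed.

Lemma formal_eval_cat (W : lmodType k) (phi : U -> V -> W) s t :
  formal_eval phi (s ++ t) = formal_eval phi s + formal_eval phi t.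
Proof. exact: big_cat. Qed.

Definition formal_scale (a : k) (s : seq (U * V)) : seq (U * V) :=
  [seq (a *: p.1, p.2) | p <- s].

Lemma formal_eval_scale (W : lmodType k) (phi : {bilinear U -> V -> W}) a s :
  formal_eval phi (formal_scale a s) = a *: formal_eval phi s.
Proof.
rewrite /formal_eval big_map scaler_sumr; apply: eq_bigr => p _.
by rewrite linearZl_LR.
Qed.

Definition tensor_add (x y : tensor) := sum_class (repr x ++ repr y).
Definition tensor_scale a (x : tensor) := sum_class (formal_scale a (repr x)).
Definition tensor_opp (x : tensor) := tensor_scale (-1) x.

Lemma tensor_addE s t :
  tensor_add (sum_class s) (sum_class t) = sum_class (s ++ t).
Proof.
by apply/eqP/sum_classP => W phi; rewrite !formal_eval_cat !formal_eval_repr.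
Qed.

Lemma tensor_scaleE a s :
  tensor_scale a (sum_class s) = sum_class (formal_scale a s).
Proof.
by apply/eqP/sum_classP => W phi; rewrite !formal_eval_scale formal_eval_repr.
Qed.

Lemma tensor_addA : associative tensor_add.
Proof.
move=> x y z; rewrite -(sum_classK x) -(sum_classK y) -(sum_classK z).
by rewrite !tensor_addE catA.
Qed.

Lemma tensor_addC : commutative tensor_add.
Proof.
move=> x y; rewrite -(sum_classK x) -(sum_classK y) !tensor_addE.
by apply/eqP/sum_classP => W phi; rewrite !formal_eval_cat addrC.
Qed.

Lemma tensor_add0 : left_id (sum_class [::]) tensor_add.
Proof. by move=> x; rewrite -(sum_classK x) tensor_addE. Qed.

Lemma tensor_addN : left_inverse (sum_class [::]) tensor_opp tensor_add.
Proof.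
move=> x; rewrite -(sum_classK x) /tensor_opp tensor_scaleE tensor_addE.
apply/eqP/sum_classP => W phi.
by rewrite formal_eval_cat formal_eval_scale scaleN1r addNr /formal_eval big_nil.
Qed.

HB.instance Definition _ := GRing.isZmodule.Build tensor
  tensor_addA tensor_addC tensor_add0 tensor_addN.

Lemma tensor_scaleA a b x :
  tensor_scale a (tensor_scale b x) = tensor_scale (a * b) x.
Proof.
rewrite -(sum_classK x) !tensor_scaleE.
by apply/eqP/sum_classP => W phi; rewrite !formal_eval_scale scalerA.
Qed.

Lemma tensor_scale1 : left_id 1 tensor_scale.
Proof.
move=> x; rewrite -(sum_classK x) !tensor_scaleE.
by apply/eqP/sum_classP => W phi; rewrite !formal_eval_scale scale1r.
Qed.

Lemma tensor_scaleDr : right_distributive tensor_scale +%R.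
Proof.
move=> a x y; rewrite -(sum_classK x) -(sum_classK y) [X in tensor_scale a X = _]tensor_addE.
by rewrite !tensor_scaleE [RHS]tensor_addE /formal_scale map_cat.
Qed.

Lemma tensor_scaleDl x : {morph tensor_scale^~ x : a b / a + b}.
Proof.
move=> a b; rewrite -(sum_classK x) !tensor_scaleE [RHS]tensor_addE.
apply/eqP/sum_classP => W phi.
by rewrite formal_eval_cat !formal_eval_scale scalerDl.
Qed.

HB.instance Definition _ := GRing.Zmodule_isLmodule.Build k tensor
  tensor_scaleA tensor_scale1 tensor_scaleDr tensor_scaleDl.

Definition pure (u : U) (v : V) : tensor := sum_class [:: (u, v)].

Lemma sum_classD s t : sum_class s + sum_class t = sum_class (s ++ t).
Proof. exact: tensor_addE. Qed.

Lemma sum_classZ a s : a *: sum_class s = sum_class (formal_scale a s).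
Proof. exact: tensor_scaleE. Qed.

Lemma pure_bilinear : bilinear_for *:%R *:%R pure.
Proof.
split=> [v a u u' | u a v v'] /=; rewrite /pure sum_classZ sum_classD;
  apply/eqP/sum_classP => W phi;
  rewrite /formal_eval !big_cons !big_nil /= !addr0.
- by rewrite linearPl [in RHS]linearZl_LR.
- by rewrite linearPr [in RHS]linearZl_LR.
Qed.

HB.instance Definition _ :=
  bilinear_isBilinear.Build k U V tensor _ _ pure pure_bilinear.

Lemma tensor_ind (P : tensor -> Prop) :
    (forall u v, P (pure u v)) -> (forall x y, P x -> P y -> P (x + y)) ->
  forall x, P x.
Proof.
move=> Ppure Padd x; rewrite -(sum_classK x).
elim: (repr x) => [|[u v] s IHs].
  have -> : sum_class [::] = pure 0 0 by rewrite linear0r.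
  exact: Ppure.
have -> : sum_class ((u, v) :: s) = pure u v + sum_class s.
  by rewrite sum_classD.
exact: Padd.
Qed.

Definition tensor_lift (W : lmodType k) (phi : {bilinear U -> V -> W})
  (x : tensor) : W := formal_eval phi (repr x).

Section Lift.
Variables (W : lmodType k) (phi : {bilinear U -> V -> W}).

Lemma tensor_lift_linear : linear (tensor_lift phi).
Proof.
move=> a x y; rewrite /tensor_lift formal_eval_repr formal_eval_cat.
by rewrite formal_eval_repr formal_eval_scale.
Qed.

HB.instance Definition _ :=
  GRing.isLinear.Build k tensor W _ (tensor_lift phi) tensor_lift_linear.

Lemma tensor_liftE u v : tensor_lift phi (pure u v) = phi u v.
Proof. by rewrite /tensor_lift formal_eval_repr /formal_eval big_seq1. Qed.

Lemma tensor_lift_uniq (f : {linear tensor -> W}) :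
  (forall u v, f (pure u v) = phi u v) -> f =1 tensor_lift phi.
Proof.
move=> fE; elim/tensor_ind => [u v|x y fx fy]; first by rewrite tensor_liftE.
by rewrite !linearD fx fy.
Qed.

End Lift.
End Tensor.

Section TensorMap.
Variables (k : fieldType) (U U' V V' : lmodType k).
Variables (f : {linear U -> U'}) (g : {linear V -> V'}).

Definition pure_map (u : U) (v : V) : tensor U' V' := pure (f u) (g v).

Lemma pure_map_bilinear : bilinear_for *:%R *:%R pure_map.
Proof.
by split=> [v a u u' | u a v v'] /=; rewrite /pure_map linearP ?linearPl ?linearPr.
Qed.

HB.instance Definition _ :=
  bilinear_isBilinear.Build k U V (tensor U' V') _ _ pure_map pure_map_bilinear.

(* f (x) g *)
Definition tensor_map : tensor U V -> tensor U' V' := tensor_lift pure_map.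
HB.instance Definition _ := GRing.Linear.on tensor_map.

Lemma tensor_mapE u v : tensor_map (pure u v) = pure (f u) (g v).
Proof. exact: tensor_liftE. Qed.

End TensorMap.

Lemma eq_tensor_map (k : fieldType) (U U' V V' : lmodType k)
    (f f' : {linear U -> U'}) (g g' : {linear V -> V'}) :
  f =1 f' -> g =1 g' -> tensor_map f g =1 tensor_map f' g'.
Proof.
move=> ff' gg'; elim/tensor_ind => [u v|x y IHx IHy].
  by rewrite !tensor_mapE ff' gg'.
by rewrite !linearD /= IHx IHy.
Qed.

(* The map (b (x) d) (u (x) v) = mu b u (x) nu d v; it is used both for the
   product of the algebra B (x) D and for its action on M (x) N. *)
Section TensorAct.
Variables (k : fieldType) (B D U V : lmodType k).
Variables (mu : {bilinear B -> U -> U}) (nu : {bilinear D -> V -> V}).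

Definition pure_act (x : tensor U V) (b : B) (d : D) : tensor U V :=
  tensor_map (mu b) (nu d) x.

Lemma pure_act_bilinear x : bilinear_for *:%R *:%R (pure_act x).
Proof.
rewrite /pure_act; split=> [d a b b' | b a d d'] /=;
  elim/tensor_ind: x => [u v|x y IHx IHy].
- by rewrite !tensor_mapE /= linearPl linearPl.
- by rewrite !(linearD (tensor_map _ _)) /= IHx IHy scalerDr addrACA.
- by rewrite !tensor_mapE /= linearPl linearPr.
- by rewrite !(linearD (tensor_map _ _)) /= IHx IHy scalerDr addrACA.
Qed.

HB.instance Definition _ x :=
  bilinear_isBilinear.Build k B D (tensor U V) _ _ (pure_act x)
    (pure_act_bilinear x).

Definition tensor_act (t : tensor B D) (x : tensor U V) : tensor U V :=
  tensor_lift (pure_act x) t.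

Lemma tensor_actE b d u v :
  tensor_act (pure b d) (pure u v) = pure (mu b u) (nu d v).
Proof. by rewrite /tensor_act tensor_liftE /= /pure_act tensor_mapE. Qed.

Lemma tensor_act_bilinear : bilinear_for *:%R *:%R tensor_act.
Proof.
split=> [x a t t' | t a x x'] /=; first by rewrite /tensor_act linearP.
elim/tensor_ind: t => [b d|t t' IH IH'].
  by rewrite /tensor_act !tensor_liftE /= /pure_act linearP.
have actD y : tensor_act (t + t') y = tensor_act t y + tensor_act t' y.
  by rewrite /tensor_act linearD.
by rewrite !actD IH IH' scalerDr addrACA.
Qed.

HB.instance Definition _ :=
  bilinear_isBilinear.Build k (tensor B D) (tensor U V) (tensor U V) _ _
    tensor_act tensor_act_bilinear.

End TensorAct.

(** * The algebra B (x) D *)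

Section AlgTensor.
Variables (k : fieldType).

Definition alg_mul (A : algType k) (x y : A) : A := x * y.

Lemma alg_mul_bilinear (A : algType k) : bilinear_for *:%R *:%R (@alg_mul A).
Proof.
split=> [y a x x' | x a y y'] /=; rewrite /alg_mul.
  by rewrite mulrDl scalerAl.
by rewrite mulrDr scalerAr.
Qed.

HB.instance Definition _ (A : algType k) :=
  bilinear_isBilinear.Build k A A A _ _ (@alg_mul A) (@alg_mul_bilinear A).

Variables (B D : algType k).

Definition alg_tensor : Type := tensor B D.
HB.instance Definition _ := GRing.Lmodule.on alg_tensor.

Definition alg_pure (b : B) (d : D) : alg_tensor := pure b d.

Definition alg_tensor_mul (s t : alg_tensor) : alg_tensor :=
  tensor_act (@alg_mul B) (@alg_mul D) s t.

Lemma alg_tensor_mulE b d b' d' :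
  alg_tensor_mul (alg_pure b d) (alg_pure b' d') = alg_pure (b * b') (d * d').
Proof. exact: tensor_actE. Qed.

Lemma alg_tensor_mulDl : left_distributive alg_tensor_mul +%R.
Proof. by move=> s t r; rewrite /alg_tensor_mul linearDl. Qed.

Lemma alg_tensor_mulDr : right_distributive alg_tensor_mul +%R.
Proof. by move=> s t r; rewrite /alg_tensor_mul linearDr. Qed.

Lemma alg_tensor_mulA : associative alg_tensor_mul.
Proof.
move=> s t r.
elim/tensor_ind: s => [b d|s s' IH IH']; last by rewrite !alg_tensor_mulDl IH IH'.
elim/tensor_ind: t => [b' d'|t t' IH IH'].
  elim/tensor_ind: r => [b'' d''|r r' IH IH'].
    by rewrite !alg_tensor_mulE !mulrA.
  by rewrite !alg_tensor_mulDr IH IH'.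
by rewrite alg_tensor_mulDl !alg_tensor_mulDr alg_tensor_mulDl IH IH'.
Qed.

Lemma alg_tensor_mul1l : left_id (alg_pure 1 1) alg_tensor_mul.
Proof.
elim/tensor_ind => [b d|s s' IH IH']; last by rewrite alg_tensor_mulDr IH IH'.
by rewrite alg_tensor_mulE !mul1r.
Qed.

Lemma alg_tensor_mul1r : right_id (alg_pure 1 1) alg_tensor_mul.
Proof.
elim/tensor_ind => [b d|s s' IH IH']; last by rewrite alg_tensor_mulDl IH IH'.
by rewrite alg_tensor_mulE !mulr1.
Qed.

HB.instance Definition _ := GRing.Zmodule_isPzRing.Build alg_tensor
  alg_tensor_mulA alg_tensor_mul1l alg_tensor_mul1r
  alg_tensor_mulDl alg_tensor_mulDr.

(* Together with the two structures above, these laws make B (x) D a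
   k-algebra. *)
Lemma alg_tensor_scaleAl (a : k) (s t : alg_tensor) : a *: (s * t) = a *: s * t.
Proof. by rewrite [RHS](linearZl_LR (tensor_act _ _)). Qed.

Lemma alg_tensor_scaleAr (a : k) (s t : alg_tensor) : a *: (s * t) = s * (a *: t).
Proof. by rewrite [RHS](linearZr_LR (tensor_act _ _)). Qed.

End AlgTensor.

(** * The B (x) D-module M (x) N *)

Section Restriction.
Variables (k : fieldType) (B : algType k).

(* The k-vector space underlying a B-module. *)
Definition restr (M : lmodType B) : Type := M.

Section RestrModule.
Variable M : lmodType B.

HB.instance Definition _ := GRing.Zmodule.on (restr M).

Definition restr_scale (a : k) (m : restr M) : restr M := a%:A *: (m : M).

Lemma restr_scaleA a b m :
  restr_scale a (restr_scale b m) = restr_scale (a * b) m.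
Proof. by rewrite /restr_scale scalerA -scalerAl mul1r scalerA. Qed.

Lemma restr_scale1 : left_id 1 restr_scale.
Proof. by move=> m; rewrite /restr_scale !scale1r. Qed.

Lemma restr_scaleDr : right_distributive restr_scale +%R.
Proof. by move=> a m m'; rewrite /restr_scale scalerDr. Qed.

Lemma restr_scaleDl m : {morph restr_scale^~ m : a b / a + b}.
Proof. by move=> a b; rewrite /restr_scale scalerDl scalerDl. Qed.

HB.instance Definition _ := GRing.Zmodule_isLmodule.Build k (restr M)
  restr_scaleA restr_scale1 restr_scaleDr restr_scaleDl.

Definition restr_act (b : B) (m : restr M) : restr M := b *: (m : M).

Lemma restr_act_bilinear : bilinear_for *:%R *:%R restr_act.
Proof.
split=> [m a b b' | b a m m'] /=; rewrite /restr_act.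
  rewrite [LHS]scalerDl; congr (_ + _).
  by rewrite [RHS]scalerA -scalerAl mul1r.
rewrite [LHS]scalerDr; congr (_ + _).
by rewrite [LHS]scalerA [RHS]scalerA -scalerAr mulr1 -scalerAl mul1r.
Qed.

HB.instance Definition _ :=
  bilinear_isBilinear.Build k B (restr M) (restr M) _ _
    restr_act restr_act_bilinear.

End RestrModule.

Section RestrMap.
Variables (M M' : lmodType B) (f : {linear M -> M'}).

Definition restr_map : restr M -> restr M' := f.

Lemma restr_map_linear : linear restr_map.
Proof. by move=> a x y; rewrite /restr_map [LHS]linearD /= [X in X + _]linearZ. Qed.

HB.instance Definition _ :=
  GRing.isLinear.Build k (restr M) (restr M') _ restr_map restr_map_linear.

End RestrMap.
End Restriction.

Section ModTensor.
Variables (k : fieldType) (B D : algType k).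

Section Module.
Variables (M : lmodType B) (N : lmodType D).

Definition mod_tensor : Type := tensor (restr M) (restr N).
HB.instance Definition _ := GRing.Zmodule.on mod_tensor.

Definition mod_pure (m : M) (n : N) : mod_tensor :=
  pure (m : restr M) (n : restr N).

Definition mod_tensor_scale (t : alg_tensor B D) (x : mod_tensor) : mod_tensor :=
  tensor_act (@restr_act k B M) (@restr_act k D N) t x.

Lemma mod_tensor_scaleE b d m n :
  mod_tensor_scale (alg_pure b d) (mod_pure m n) = mod_pure (b *: m) (d *: n).
Proof. exact: tensor_actE. Qed.

Lemma mod_tensor_scaleDl x : {morph mod_tensor_scale^~ x : s t / s + t}.
Proof. by move=> s t; rewrite /mod_tensor_scale linearDl. Qed.

Lemma mod_tensor_scaleDr : right_distributive mod_tensor_scale +%R.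
Proof. by move=> s x y; rewrite /mod_tensor_scale linearDr. Qed.

Lemma mod_tensor_scaleA s t x :
  mod_tensor_scale s (mod_tensor_scale t x) = mod_tensor_scale (s * t) x.
Proof.
elim/tensor_ind: s => [b d|s s' IH IH'].
  elim/tensor_ind: t => [b' d'|t t' IH IH'].
    elim/tensor_ind: x => [m n|x y IH IH'].
      by rewrite [_ * _]alg_tensor_mulE !mod_tensor_scaleE !scalerA.
    by rewrite !mod_tensor_scaleDr IH IH'.
  by rewrite mulrDr !mod_tensor_scaleDl mod_tensor_scaleDr IH IH'.
by rewrite mulrDl !mod_tensor_scaleDl IH IH'.
Qed.

Lemma mod_tensor_scale1 : left_id 1 mod_tensor_scale.
Proof.
elim/tensor_ind => [m n|x y IH IH']; last by rewrite mod_tensor_scaleDr IH IH'.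
by rewrite [LHS]mod_tensor_scaleE !scale1r.
Qed.

HB.instance Definition _ :=
  GRing.Zmodule_isLmodule.Build (alg_tensor B D) mod_tensor
    mod_tensor_scaleA mod_tensor_scale1 mod_tensor_scaleDr mod_tensor_scaleDl.

Lemma mod_pureZ b d m n :
  alg_pure b d *: mod_pure m n = mod_pure (b *: m) (d *: n).
Proof. exact: mod_tensor_scaleE. Qed.

End Module.

Section Map.
Variables (M M' : lmodType B) (N N' : lmodType D).
Variables (f : {linear M -> M'}) (g : {linear N -> N'}).

(* f (x) g, as a map of B (x) D-modules *)
Definition mod_tensor_map : mod_tensor M N -> mod_tensor M' N' :=
  tensor_map (restr_map f) (restr_map g).

Lemma mod_tensor_mapE m n :
  mod_tensor_map (mod_pure m n) = mod_pure (f m) (g n).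
Proof. exact: tensor_mapE. Qed.

Lemma mod_tensor_mapD : {morph mod_tensor_map : x y / x + y}.
Proof. by move=> x y; rewrite [LHS](linearD (tensor_map _ _)). Qed.

Lemma mod_tensor_map_linear : linear mod_tensor_map.
Proof.
move=> s x y; rewrite mod_tensor_mapD; congr (_ + _).
elim/tensor_ind: s => [b d|s s' IH IH'].
  elim/tensor_ind: x => [m n|x x' IH IH'].
    rewrite -[pure b d]/(alg_pure b d) -[pure m n]/(mod_pure m n).
    by rewrite mod_pureZ !mod_tensor_mapE mod_pureZ (linearZ_LR f) (linearZ_LR g).
  by rewrite scalerDr !mod_tensor_mapD IH IH' scalerDr.
by rewrite !scalerDl mod_tensor_mapD IH IH'.
Qed.

HB.instance Definition _ := GRing.isLinear.Build (alg_tensor B D)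
  (mod_tensor M N) (mod_tensor M' N') _ mod_tensor_map mod_tensor_map_linear.

End Map.
End ModTensor.

(** * Augmented complexes *)

(* Modules and maps ... -> P_1 -> P_0 -> M -> 0, with M in degree -1.
   [aug_diff n] is the differential P_(n+1) -> P_n and [aug_map] is the
   differential P_0 -> M.  The sequence of the [aug_obj n] with the maps
   [aug_diff n] is the deleted version. *)
Record aug_seq (R : pzRingType) := AugSeq {
  aug_obj : nat -> lmodType R;
  aug_base : lmodType R;
  aug_diff : forall n, {linear aug_obj n.+1 -> aug_obj n};
  aug_map : {linear aug_obj 0%N -> aug_base}
}.

Section AugSeq.
Variables (R : pzRingType) (C : aug_seq R).

Definition fg_aug_seq : Prop :=
  fg_module (aug_base C) /\ forall n, fg_module (aug_obj C n).

Definition is_complex : Prop :=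
  (forall x, aug_map C (aug_diff C 0 x) = 0) /\
  (forall n x, aug_diff C n (aug_diff C n.+1 x) = 0).

Definition is_exact : Prop :=
  [/\ (forall m, exists x, aug_map C x = m),
      (forall x, aug_map C x = 0 -> exists y, aug_diff C 0 y = x)
    & (forall n x, aug_diff C n x = 0 -> exists y, aug_diff C n.+1 y = x)].

Definition acyclic_complex : Prop := is_complex /\ is_exact.

(* [hM] and [h n] are the components of the homotopy in degrees -1 and n. *)
Definition is_homotopy (hM : {linear aug_base C -> aug_obj C 0%N})
    (h : forall n, {linear aug_obj C n -> aug_obj C n.+1}) : Prop :=
  [/\ (forall m, aug_map C (hM m) = m),
      (forall x, aug_diff C 0 (h 0%N x) + hM (aug_map C x) = x)
    & (forall n x,
         aug_diff C n.+1 (h n.+1 x) + h n (aug_diff C n x) = x)].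

Definition admits_homotopy : Prop := exists hM h, is_homotopy hM h.

End AugSeq.

(** * The total complex *)

Section Total.
Variables (k : fieldType) (B D : algType k) (C : aug_seq B) (E : aug_seq D).

Local Notation P := (aug_obj C).
Local Notation Q := (aug_obj E).

(* The direct sum of the P_n (x) Q_m over the finitely many pairs with
   n + m = s, as families indexed by these pairs. *)
Definition tot (s : nat) : Type :=
  forall n m : nat, (n + m)%N = s -> mod_tensor (P n) (Q m).

Lemma totP s (x y : tot s) :
  (forall n m (e : (n + m)%N = s), x n m e = y n m e) -> x = y.
Proof.
move=> xy; apply: functional_extensionality_dep => n.
by apply: functional_extensionality_dep => m; apply: functional_extensionality_dep.
Qed.

Section TotModule.
Variable s : nat.

HB.instance Definition _ := gen_eqMixin (tot s).
HB.instance Definition _ := gen_choiceMixin (tot s).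

Definition tot_zero : tot s := fun n m e => 0.
Definition tot_opp (x : tot s) : tot s := fun n m e => - x n m e.
Definition tot_add (x y : tot s) : tot s := fun n m e => x n m e + y n m e.
Definition tot_scale (a : alg_tensor B D) (x : tot s) : tot s :=
  fun n m e => a *: x n m e.

Lemma tot_addA : associative tot_add.
Proof. by move=> x y z; apply: totP => n m e; apply: addrA. Qed.
Lemma tot_addC : commutative tot_add.
Proof. by move=> x y; apply: totP => n m e; apply: addrC. Qed.
Lemma tot_add0 : left_id tot_zero tot_add.
Proof. by move=> x; apply: totP => n m e; apply: add0r. Qed.
Lemma tot_addN : left_inverse tot_zero tot_opp tot_add.
Proof. by move=> x; apply: totP => n m e; apply: addNr. Qed.

HB.instance Definition _ :=
  GRing.isZmodule.Build (tot s) tot_addA tot_addC tot_add0 tot_addN.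

Lemma tot_scaleA a b x : tot_scale a (tot_scale b x) = tot_scale (a * b) x.
Proof. by apply: totP => n m e; apply: scalerA. Qed.
Lemma tot_scale1 : left_id 1 tot_scale.
Proof. by move=> x; apply: totP => n m e; apply: scale1r. Qed.
Lemma tot_scaleDr : right_distributive tot_scale +%R.
Proof. by move=> a x y; apply: totP => n m e; apply: scalerDr. Qed.
Lemma tot_scaleDl x : {morph tot_scale^~ x : a b / a + b}.
Proof. by move=> a b; apply: totP => n m e; apply: scalerDl. Qed.

HB.instance Definition _ := GRing.Zmodule_isLmodule.Build (alg_tensor B D)
  (tot s) tot_scaleA tot_scale1 tot_scaleDr tot_scaleDl.

End TotModule.

Lemma succ_addl s n m : (n + m)%N = s -> (n.+1 + m)%N = s.+1.
Proof. by move=> <-; rewrite addSn. Qed.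

Lemma succ_addr s n m : (n + m)%N = s -> (n + m.+1)%N = s.+1.
Proof. by move=> <-; rewrite addnS. Qed.

(* The component in P_n (x) Q_m of the differential of x receives
   (d_(n+1) (x) 1) from P_(n+1) (x) Q_m and (-1)^n (1 (x) delta_(m+1)) from
   P_n (x) Q_(m+1).  The maps d_0 and delta_0 do not occur, since the
   differentials of the deleted complexes vanish in degree 0. *)
Definition tot_diff (s : nat) (x : tot s.+1) : tot s := fun n m e =>
  mod_tensor_map (aug_diff C n) idfun (x n.+1 m (succ_addl e))
  + (-1) ^+ n *: mod_tensor_map idfun (aug_diff E m) (x n m.+1 (succ_addr e)).

Lemma tot_diff_linear s : linear (@tot_diff s).
Proof.
move=> a x y; apply: totP => n m e; rewrite /tot_diff.
rewrite [X in X + _]linearP [X in _ *: X]linearP /=.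
rewrite [RHS]/GRing.add /= /tot_add [X in _ = X + _]/GRing.scale /= /tot_scale.
rewrite !scalerDr addrACA; congr (_ + _ + (_ + _)).
by rewrite !scalerA commr_sign.
Qed.

HB.instance Definition _ s := GRing.isLinear.Build (alg_tensor B D)
  (tot s.+1) (tot s) _ (@tot_diff s) (@tot_diff_linear s).

(* Delta_0 = d_0 (x) delta_0 *)
Definition tot_aug (x : tot 0) : mod_tensor (aug_base C) (aug_base E) :=
  mod_tensor_map (aug_map C) (aug_map E) (x 0%N 0%N (addn0 0)).

Lemma tot_aug_linear : linear tot_aug.
Proof. by move=> a x y; rewrite /tot_aug linearP. Qed.

HB.instance Definition _ := GRing.isLinear.Build (alg_tensor B D)
  (tot 0) (mod_tensor (aug_base C) (aug_base E)) _ tot_aug tot_aug_linear.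

Definition tot_seq : aug_seq (alg_tensor B D) :=
  @AugSeq (alg_tensor B D) tot (mod_tensor (aug_base C) (aug_base E))
    tot_diff tot_aug.

End Total.

(* Main.v *)
From HB Require Import structures.
Require Import Defs.
From mathcomp Require Import all_boot all_order all_algebra all_field.
From mathcomp Require Import boolp.

Set Implicit Arguments.
Unset Strict Implicit.
Unset Printing Implicit Defensive.

Import GRing.Theory.
Local Open Scope ring_scope.

(** With contractions (s, h) of C and (t, eta) of E, where s and t are the
    components in degree -1, the total complex is contracted by s (x) t in
    degree -1 and by h (x) 1 + (s d_0) (x) eta in degrees >= 0, the second
    summand living on P_0 (x) Q_m only.  The identity holds on P_n (x) Q_m
    because d h + h d is 1 for n > 0 and 1 - s d_0 for n = 0, and likewise for
    eta.  Exactness of a complex follows from the existence of a contraction. *)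

(** * Finite generation *)

(** With generators and coefficients indexed by [nat], their types no longer depend on the number of
    generators, which eases a simultaneous choice for many modules. *)
Lemma fg_moduleP (R : pzRingType) (M : lmodType R) :
  fg_module M <-> exists (p : nat) (g : nat -> M),
    forall x, exists c : nat -> R, x = \sum_(i < p) c i *: g i.
Proof.
split=> [[s sP]|[p [g gP]]].
  exists (size s), (fun i => s`_i) => x; have [c ->] := sP x.
  (* The default 0 is never reached in the sum, where [i < size s]. *)
  exists (fun i => if insub i is Some j then c j else 0).
  by apply: eq_bigr => i _; rewrite valK.
exists (mkseq g p) => x; have [c ->] := gP x.
exists (fun i => c i); rewrite size_mkseq.
by apply: eq_bigr => i _; rewrite nth_mkseq.
Qed.

(** Meant for index types of pairs (tensor products) and of dependent pairs (direct sums). *)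
Lemma fg_module_fin (R : pzRingType) (M : lmodType R) (T : finType) (g : T -> M) :
  (forall x, exists c : T -> R, x = \sum_t c t *: g t) -> fg_module M.
Proof.
move=> gP; exists (image g T) => x; have [c ->] := gP x.
exists (fun i => c (enum_val (cast_ord (size_image g T) i))).
rewrite (reindex (fun i => enum_val (cast_ord (size_image g T) i))) /=.
  by apply: eq_bigr => i _; rewrite -(nth_image 0 g).
exists (fun t => cast_ord (esym (size_image g T)) (enum_rank t)) => i _.
  by rewrite enum_valK cast_ordK.
by rewrite cast_ordKV enum_rankK.
Qed.

(** * Pure tensors and functoriality of the tensor product of modules *)

Section ModTensorTheory.
Variables (k : fieldType) (B D : algType k).

Lemma mod_tensor_ind (M : lmodType B) (N : lmodType D)
    (P : mod_tensor M N -> Prop) :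
    (forall m n, P (mod_pure m n)) -> (forall x y, P x -> P y -> P (x + y)) ->
  forall x, P x.
Proof. exact: (@tensor_ind k (restr M) (restr N)). Qed.

Section Pure.
Variables (M : lmodType B) (N : lmodType D).

Lemma mod_pureDl m m' n :
  mod_pure (m + m') n = mod_pure m n + mod_pure m' n :> mod_tensor M N.
Proof. exact: (linearDl (@pure k (restr M) (restr N))). Qed.

Lemma mod_pureDr m n n' :
  mod_pure m (n + n') = mod_pure m n + mod_pure m n' :> mod_tensor M N.
Proof. exact: (linearDr (@pure k (restr M) (restr N))). Qed.

Lemma mod_pure0l n : mod_pure 0 n = 0 :> mod_tensor M N.
Proof. exact: (linear0l (@pure k (restr M) (restr N))). Qed.

Lemma mod_pure0r m : mod_pure m 0 = 0 :> mod_tensor M N.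
Proof. exact: (linear0r (@pure k (restr M) (restr N))). Qed.

Lemma mod_pure_suml (I : finType) (F : I -> M) n :
  mod_pure (\sum_i F i) n = \sum_i mod_pure (F i) n :> mod_tensor M N.
Proof.
by apply: (big_morph (fun m => mod_pure m n)) => [m m'|]; rewrite ?mod_pureDl ?mod_pure0l.
Qed.

Lemma mod_pure_sumr (I : finType) m (F : I -> N) :
  mod_pure m (\sum_i F i) = \sum_i mod_pure m (F i) :> mod_tensor M N.
Proof.
by apply: (big_morph (mod_pure m)) => [n n'|]; rewrite ?mod_pureDr ?mod_pure0r.
Qed.

(** Expanding both factors of a pure tensor gives coefficients c_i (x) c'_j on the products of
    generators. *)
Lemma fg_mod_tensor : fg_module M -> fg_module N -> fg_module (mod_tensor M N).
Proof.
move=> [s sP] [t tP].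
apply: (@fg_module_fin _ _ ('I_(size s) * 'I_(size t))%type
  (fun i => mod_pure s`_i.1 t`_i.2)).
elim/mod_tensor_ind => [m n|x y [c ->] [c' ->]]; last first.
  exists (fun i => c i + c' i); rewrite -big_split.
  by apply: eq_bigr => i _; rewrite scalerDl.
have [[c ->] [c' ->]] := (sP m, tP n).
exists (fun i => alg_pure (c i.1) (c' i.2)); rewrite mod_pure_suml.
under eq_bigr => i _ do rewrite mod_pure_sumr.
by rewrite pair_big; apply: eq_bigr => i _; rewrite mod_pureZ.
Qed.

Lemma mod_tensor_map_id (x : mod_tensor M N) : mod_tensor_map idfun idfun x = x.
Proof.
elim/mod_tensor_ind: x => [m n|x y IHx IHy]; first by rewrite mod_tensor_mapE.
by rewrite mod_tensor_mapD IHx IHy.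
Qed.

End Pure.

Section Map.
Variables (M M' M'' : lmodType B) (N N' N'' : lmodType D).

Lemma eq_mod_tensor_map (f f' : {linear M -> M'}) (g g' : {linear N -> N'}) :
  f =1 f' -> g =1 g' -> mod_tensor_map f g =1 mod_tensor_map f' g'.
Proof. by move=> ff' gg' x; apply: eq_tensor_map. Qed.

Lemma mod_tensor_map_comp (f : {linear M' -> M''}) (f' : {linear M -> M'})
    (g : {linear N' -> N''}) (g' : {linear N -> N'}) x :
  mod_tensor_map f g (mod_tensor_map f' g' x) =
  mod_tensor_map (f \o f') (g \o g') x.
Proof.
elim/mod_tensor_ind: x => [m n|x y IHx IHy]; first by rewrite !mod_tensor_mapE.
by rewrite !mod_tensor_mapD IHx IHy.
Qed.

Lemma mod_tensor_mapDl (f f' : {linear M -> M'}) (g : {linear N -> N'}) x :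
  mod_tensor_map (f \+ f') g x = mod_tensor_map f g x + mod_tensor_map f' g x.
Proof.
elim/mod_tensor_ind: x => [m n|x y IHx IHy].
  by rewrite !mod_tensor_mapE /= mod_pureDl.
by rewrite !mod_tensor_mapD IHx IHy addrACA.
Qed.

Lemma mod_tensor_mapDr (f : {linear M -> M'}) (g g' : {linear N -> N'}) x :
  mod_tensor_map f (g \+ g') x = mod_tensor_map f g x + mod_tensor_map f g' x.
Proof.
elim/mod_tensor_ind: x => [m n|x y IHx IHy].
  by rewrite !mod_tensor_mapE /= mod_pureDr.
by rewrite !mod_tensor_mapD IHx IHy addrACA.
Qed.

(** Vanishing is assumed pointwise so that composites such as d d qualify. *)
Lemma mod_tensor_map0l (f : {linear M -> M'}) (g : {linear N -> N'}) x :
  f =1 (fun=> 0) -> mod_tensor_map f g x = 0.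
Proof.
move=> f0; elim/mod_tensor_ind: x => [m n|x y IHx IHy].
  by rewrite mod_tensor_mapE f0 mod_pure0l.
by rewrite mod_tensor_mapD IHx IHy addr0.
Qed.

Lemma mod_tensor_map0r (f : {linear M -> M'}) (g : {linear N -> N'}) x :
  g =1 (fun=> 0) -> mod_tensor_map f g x = 0.
Proof.
move=> g0; elim/mod_tensor_ind: x => [m n|x y IHx IHy].
  by rewrite mod_tensor_mapE g0 mod_pure0r.
by rewrite mod_tensor_mapD IHx IHy addr0.
Qed.

End Map.

(** Brings mixed terms to a common form, so that opposite signs cancel them. *)
Lemma mod_tensor_map_exchange (M M' : lmodType B) (N N' : lmodType D)
    (f : {linear M -> M'}) (g : {linear N -> N'}) x :
  mod_tensor_map f idfun (mod_tensor_map idfun g x) =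
  mod_tensor_map idfun g (mod_tensor_map f idfun x).
Proof. by rewrite !mod_tensor_map_comp; apply: eq_mod_tensor_map. Qed.

End ModTensorTheory.

(** On a cycle x the term h (d x) vanishes, leaving x = d (h x). *)
Lemma homotopy_exact (R : pzRingType) (C : aug_seq R) :
  admits_homotopy C -> is_exact C.
Proof.
move=> [hM [h [hM_sec h0 hS]]]; split=> [m|x x0|n x x0].
- by exists (hM m).
- by exists (h 0%N x); rewrite -[RHS]h0 x0 linear0 addr0.
- by exists (h n.+1 x); rewrite -[RHS]hS x0 linear0 addr0.
Qed.

(** * The total complex: finite generation and vanishing of the squared differential *)

Section Total.
Variables (k : fieldType) (B D : algType k) (C : aug_seq B) (E : aug_seq D).
Local Notation P := (aug_obj C).
Local Notation Q := (aug_obj E).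

(** The same component is reached along different paths, each with its own proof of [n + m = s]. *)
Lemma tot_irr s (x : tot C E s) n m (e e' : (n + m)%N = s) : x n m e = x n m e'.
Proof. by rewrite (eq_irrelevance e e'). Qed.

Lemma totDE s (x y : tot C E s) n m (e : (n + m)%N = s) :
  (x + y) n m e = x n m e + y n m e.
Proof. by []. Qed.

Lemma totZE s a (x : tot C E s) n m (e : (n + m)%N = s) :
  (a *: x) n m e = a *: x n m e.
Proof. by []. Qed.

Lemma tot_sumE s (I : finType) (F : I -> tot C E s) n m (e : (n + m)%N = s) :
  (\sum_i F i) n m e = \sum_i F i n m e.
Proof. by apply: (big_morph (fun x : tot C E s => x n m e)). Qed.

(** The pairs with n + m = s are the (i, s - i) with i <= s, so the generators of these finitely
    many summands suffice. *)
Lemma fg_tot s :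
  (forall n, fg_module (P n)) -> (forall m, fg_module (Q m)) ->
  fg_module (tot C E s).
Proof.
move=> fgP fgQ.
have fgPQ n m : {p : nat & {g : nat -> mod_tensor (P n) (Q m) &
    forall x, {c : nat -> alg_tensor B D | x = \sum_(i < p) c i *: g i}}}.
  have /fg_moduleP/cid [p /cid [g gP]] := fg_mod_tensor (fgP n) (fgQ m).
  by exists p, g => x; apply: cid.
pose p n m := projT1 (fgPQ n m).
pose g n m := projT1 (projT2 (fgPQ n m)).
have gP n m x : {c : nat -> alg_tensor B D | x = \sum_(i < p n m) c i *: g n m i}.
  exact: projT2 (projT2 (fgPQ n m)) x.
(* Taking [g n m] instead of [g] at [tag i] and [s - tag i] avoids a transport between tensor
   products. *)
pose G (i : {i : 'I_s.+1 & 'I_(p i (s - i)%N)}) : tot C E s :=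
  fun n m _ => if n == tag i then g n m (tagged i) else 0.
apply: (@fg_module_fin _ _ _ G) => x.
pose c (i : 'I_s.+1) := projT1 (gP _ _ (x i (s - i)%N (subnKC (leq_ord i)))).
exists (fun i => c (tag i) (nat_of_ord (tagged i))).
apply: totP => n m e; rewrite tot_sumE.
have ltns : (n < s.+1)%N by rewrite -e ltnS leq_addr.
transitivity (\sum_(i < s.+1) \sum_(j < p i (s - i)%N) c i j *: G (Tagged _ j) n m e).
  rewrite (bigD1 (Ordinal ltns)) //= [X in _ + X]big1 ?addr0 => [|i ni]; last first.
    apply: big1 => j _; rewrite /G /= ifN ?scaler0 // eq_sym.
    by apply: contraNneq ni => ni; apply/eqP/val_inj.
  rewrite /c /G /= eqxx.
  (* The proofs are generalized so that [s - n] can be replaced by [m] in the dependent types. *)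
  move: (leq_ord _) => /= le_ns.
  have e' : (s - n)%N = m by rewrite -e addKn.
  move: (subnKC _) => /=; rewrite e' => e''.
  by rewrite -(svalP (gP _ _ _)) (eq_irrelevance e e'').
by rewrite sig_big_dep.
Qed.

Lemma tot_is_complex :
  is_complex C -> is_complex E -> is_complex (tot_seq C E).
Proof.
move=> [C0 CS] [E0 ES]; split=> [x|s x] /=.
  rewrite /tot_aug /tot_diff expr0 scale1r mod_tensor_mapD.
  rewrite !mod_tensor_map_comp mod_tensor_map0l ?add0r => [|y /=]; last exact: C0.
  by apply: mod_tensor_map0r => y /=; apply: E0.
apply: totP => n m e; rewrite /tot_diff !mod_tensor_mapD !linearZ_LR /=.
rewrite [X in X + _ + _](_ : _ = 0) ?add0r; last first.
  by rewrite mod_tensor_map_comp mod_tensor_map0l // => y /=; apply: CS.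
rewrite [X in _ + _ *: (_ + _ *: X)](_ : _ = 0) ?scaler0 ?addr0; last first.
  by rewrite mod_tensor_map_comp mod_tensor_map0r // => y /=; apply: ES.
(* Both mixed terms come from P_(n+1) (x) Q_(m+1), with signs (-1)^(n+1) and (-1)^n. *)
rewrite mod_tensor_map_exchange (tot_irr x _ (succ_addl (succ_addr e))).
by rewrite exprS mulN1r scaleNr addNr.
Qed.

(** * The contraction of the total complex *)

Section Homotopy.
Variables (s : {linear aug_base C -> P 0%N}) (h : forall n, {linear P n -> P n.+1}).
Variables (t : {linear aug_base E -> Q 0%N}) (eta : forall m, {linear Q m -> Q m.+1}).
Hypotheses (hC : is_homotopy s h) (hE : is_homotopy t eta).

Lemma pred_addl r n m : (n.+1 + m)%N = r.+1 -> (n + m)%N = r.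
Proof. by case. Qed.

Lemma pred_add0r r m : (0 + m.+1)%N = r.+1 -> (0 + m)%N = r.
Proof. by case. Qed.

Definition tot_base_homotopy (x : mod_tensor (aug_base C) (aug_base E)) :
    tot C E 0 := fun n m =>
  match n, m with
  | 0, 0 => fun=> mod_tensor_map s t x
  | _, _ => fun=> 0
  end.

(** Components are sorted by target: h (x) 1 lands in n > 0, (s d_0) (x) eta in n = 0. The case (0,
    0) is vacuous, since the degree is [r.+1]. *)
Definition tot_homotopy r (x : tot C E r) : tot C E r.+1 := fun n m =>
  match n, m return (n + m)%N = r.+1 -> mod_tensor (P n) (Q m) with
  | 0, 0 => fun=> 0
  | 0, m.+1 => fun e =>
      mod_tensor_map (s \o aug_map C) (eta m) (x 0%N m (pred_add0r e))
  | n.+1, m => fun e => mod_tensor_map (h n) idfun (x n m (pred_addl e))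
  end.

Lemma tot_base_homotopy_linear : linear tot_base_homotopy.
Proof.
move=> a x y; apply: totP => n m e; rewrite totDE totZE.
by case: n m e => [|n] [|m] e /=; rewrite ?linearP // scaler0 addr0.
Qed.

HB.instance Definition _ := GRing.isLinear.Build (alg_tensor B D)
  _ (tot C E 0) _ tot_base_homotopy tot_base_homotopy_linear.

Lemma tot_homotopy_linear r : linear (@tot_homotopy r).
Proof.
move=> a x y; apply: totP => n m e; rewrite totDE totZE.
by case: n m e => [|n] [|m] e /=; rewrite ?totDE ?totZE ?linearP // scaler0 addr0.
Qed.

HB.instance Definition _ r := GRing.isLinear.Build (alg_tensor B D)
  (tot C E r) (tot C E r.+1) _ (@tot_homotopy r) (@tot_homotopy_linear r).

Lemma tot_is_homotopy : is_complex C ->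
  @is_homotopy _ (tot_seq C E) tot_base_homotopy tot_homotopy.
Proof.
case: hC => [sK h0 hS] [C0 _]; case: hE => [tK eta0 etaS].
(* For n = 0, h (x) 1 accounts for d_1 h_0 only; the complement s d_0 is left to [eta]. *)
have splitP0 m (y : mod_tensor (P 0%N) (Q m)) :
    mod_tensor_map (aug_diff C 0 \o h 0%N) idfun y +
    mod_tensor_map (s \o aug_map C) idfun y = y.
  by rewrite -mod_tensor_mapDl -[RHS]mod_tensor_map_id; apply: eq_mod_tensor_map.
split=> [x|x|r x] /=.
- rewrite /tot_aug /= mod_tensor_map_comp -[RHS]mod_tensor_map_id.
  by apply: eq_mod_tensor_map => y /=; rewrite ?sK ?tK.
- apply: totP => -[|n] [|m] // e; rewrite totDE /= /tot_diff /tot_aug /=.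
  rewrite expr0 scale1r !(tot_irr x _ e) !mod_tensor_map_comp.
  rewrite -[RHS]splitP0 -addrA; congr (_ + _).
  (* The part s d_0 (x) 1 is recovered from delta_1 eta_0 + t delta_0 = 1. *)
  rewrite [X in _ + X](eq_mod_tensor_map (f' := s \o aug_map C)
    (g' := t \o aug_map E)) // -mod_tensor_mapDr.
  by apply: eq_mod_tensor_map => y /=.
- apply: totP => -[|n] m e; rewrite totDE /tot_diff /=.
    case: m e => [|m] e //=.
    rewrite expr0 !scale1r !(tot_irr x _ e) mod_tensor_mapD !mod_tensor_map_comp.
    (* The contribution of P_1 (x) Q_m dies because d_0 d_1 = 0. *)
    rewrite [X in _ + (X + _)]mod_tensor_map0l ?add0r => [|y /=]; last first.
      by rewrite C0 linear0.
    rewrite -[RHS]splitP0 -addrA; congr (_ + _).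
    rewrite -mod_tensor_mapDr; apply: eq_mod_tensor_map => y //=.
    exact: etaS.
  (* For n > 0 the two h (x) delta terms carry opposite signs, which leaves (d h + h d) (x) 1. *)
  rewrite !(tot_irr x _ e) mod_tensor_mapD linearZ_LR /= mod_tensor_map_exchange.
  rewrite (tot_irr x _ (succ_addr (pred_addl e))) exprS mulN1r scaleNr.
  rewrite addrACA addNr addr0 !mod_tensor_map_comp -mod_tensor_mapDl.
  by rewrite -[RHS]mod_tensor_map_id; apply: eq_mod_tensor_map => y //=; apply: hS.
Qed.

End Homotopy.
End Total.

Theorem lemma4p5 (k : fieldType) (k_perfect : perfect_field k)
    (k_char : 2%N \notin [pchar k])
    (B D : falgType k) (C : aug_seq B) (E : aug_seq D)
    (C_fg : fg_aug_seq C) (C_acyclic : acyclic_complex C)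
    (C_homotopy : admits_homotopy C)
    (E_fg : fg_aug_seq E) (E_acyclic : acyclic_complex E)
    (E_homotopy : admits_homotopy E) :
  [/\ fg_aug_seq (tot_seq C E),
      acyclic_complex (tot_seq C E)
    & admits_homotopy (tot_seq C E)].
Proof.
have [C_complex _] := C_acyclic; have [E_complex _] := E_acyclic.
have tot_admits : admits_homotopy (tot_seq C E).
  have [s [h hC]] := C_homotopy; have [t [eta hE]] := E_homotopy.
  exists (tot_base_homotopy s t), (@tot_homotopy _ _ _ C E s h eta).
  exact: tot_is_homotopy.
split=> //.
  split; first by apply: fg_mod_tensor; [case: C_fg | case: E_fg].
  by move=> n; apply: fg_tot; [case: C_fg | case: E_fg].
split; first exact: tot_is_complex.
exact: homotopy_exact.
Qed.
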